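(* Let $d\ge 2$, $m\ge n\ge 1$, and let $\mathbf V=(V_{j,k})_{j,k=1}^m\in\mathrm U(dm)$ with blocks $V_{j,k}\in\mathrm M_d(\mathbb C)$ be the single-particle propagator of a number-conserving fermionic linear optics (FLO) circuit $U(\mathbf V)$. Let $\boldsymbol c$ be a collision-free monitoring record with selected output blocks $\ell_1<\cdots<\ell_n$, and let $\mathbf S=(S_{t,k})_{t,k=1}^n$ with $S_{t,k}:=V_{\ell_t,\,m-n+k}\in\mathrm M_d(\mathbb C)$. Then, conditioned on $\boldsymbol c$, the encoded FLO circuit induces on the selected $n$ blocks the (unnormalized) operator on $(\mathbb C^d)^{\otimes n}$ $$D_{\boldsymbol c}\,U(\mathbf V)\,E\;=\;\det\nolimits_{\otimes}(\mathbf S):=\sum_{\sigma\in\mathfrak S_n}\operatorname{sgn}(\sigma)\Bigl(\bigotimes_{t=1}^n S_{t,\sigma(t)}\Bigr)\mathcal P_{\sigma^{-1}},$$ where $E$ is the encoding, $D_{\boldsymbol c}$ is post-selection on $\boldsymbol c$ followed by decoding, and $\mathcal P_\sigma$ are the tensor-factor permutation operators.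
   Context: There are $dm$ fermionic modes with creation operators $a^\dagger_{j,\alpha}$ ($1\le j\le m$ the block, $0\le\alpha\le d-1$ the internal label), with vacuum $|{\rm vac}\rangle$. The second-quantized unitary $U(\mathbf V)$ fixes the vacuum and satisfies $U(\mathbf V)a^\dagger_{k,\alpha}U(\mathbf V)^\dagger=\sum_{j=1}^m\sum_{\nu=0}^{d-1}(V_{j,k})_{\nu,\alpha}a^\dagger_{j,\nu}$. The occupied input blocks are $m-n+1,\dots,m$. The encoding $E:(\mathbb C^d)^{\otimes n}\to\wedge^n(\mathbb C^{dm})$ is the linear map $|\alpha_1,\dots,\alpha_n\rangle\mapsto a^\dagger_{m-n+1,\alpha_1}\cdots a^\dagger_{m,\alpha_n}|{\rm vac}\rangle$. A collision-free record $\boldsymbol c\in\{0,1\}^m$ has exactly $n$ ones, at positions $\ell_1<\cdots<\ell_n$; conditioning on it means projecting (without renormalizing) onto the span of states with exactly one fermion in each block $\ell_1,\dots,\ell_n$ and none elsewhere, and decoding identifies $a^\dagger_{\ell_1,\nu_1}\cdots a^\dagger_{\ell_n,\nu_n}|{\rm vac}\rangle\mapsto|\nu_1,\dots,\nu_n\rangle$. $D_{\boldsymbol c}:\wedge^n(\mathbb C^{dm})\to(\mathbb C^d)^{\otimes n}$ is the composition of this projection and this identification. $\mathfrak S_n$ is the symmetric group, and $\mathcal P_\sigma(v_1\otimes\cdots\otimes v_n)=v_{\sigma^{-1}(1)}\otimes\cdots\otimes v_{\sigma^{-1}(n)}$. *)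

(* Defs.v *)
From HB Require Import structures.
From mathcomp Require Import all_boot all_order all_fingroup all_algebra.
From mathcomp Require Import reals.
From mathcomp Require Import complex.

Set Implicit Arguments.
Unset Strict Implicit.
Unset Printing Implicit Defensive.

Import Order.TTheory GRing.Theory Num.Theory.
Local Open Scope ring_scope.

(* The space with orthonormal basis indexed by the finite type T, as functions
   T -> C; operators between such spaces are elements of 'Hom(_, _). *)
Notation hilb C T := {ffun T -> C^o} (only parsing).

Section Basis.
Variables (C : numClosedFieldType) (T : finType).

Definition ket (a : T) : hilb C T := [ffun b => (b == a)%:R].

Definition braket (f g : hilb C T) : C := \sum_a (f a)^* * g a.

(* The linear map determined by the images g of the basis vectors; see
   [ext_linE], [ext_lin_ket]. *)
Definition ext_lin (V : vectType C) (g : T -> V) : 'Hom(hilb C T, V) :=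
  linfun (fun f : hilb C T => \sum_a f a *: g a).

(* Hermitian adjoint: the a-coordinate of A^dagger f is <A a | f>. *)
Definition adj (A : 'End(hilb C T)) : 'End(hilb C T) :=
  ext_lin (fun b => [ffun a => braket (A (ket a)) (ket b)] : hilb C T).

Definition unitary_op (A : 'End(hilb C T)) : Prop :=
  (adj A \o A = \1)%VF /\ (A \o adj A = \1)%VF.

Lemma ext_linE (V : vectType C) (g : T -> V) f :
  ext_lin g f = \sum_a f a *: g a.
Proof.
have lin : linear (fun f : hilb C T => \sum_a f a *: g a).
  move=> k u v; rewrite scaler_sumr -big_split /=; apply: eq_bigr => a _.
  by rewrite !ffunE scalerDl scalerA.
pose m := GRing.isLinear.Build _ _ _ _ _ lin.
pose L : {linear hilb C T -> V} := HB.pack (fun f : hilb C T => \sum_a f a *: g a) m.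
exact: (lfunE L f).
Qed.

Lemma ext_lin_ket (V : vectType C) (g : T -> V) a : ext_lin g (ket a) = g a.
Proof.
rewrite ext_linE (bigD1 a) //= ffunE eqxx scale1r big1 ?addr0 // => b /negbTE ne.
by rewrite ffunE ne scale0r.
Qed.

Lemma adjP (A : 'End(hilb C T)) f g : braket f (adj A g) = braket (A f) g.
Proof.
have fE (h : hilb C T) : h = \sum_a h a *: ket a.
  apply/ffunP => b; rewrite sum_ffunE (bigD1 b) //= !ffunE eqxx big1.
    by rewrite addr0 /GRing.scale /= mulr1.
  by move=> a ne; rewrite !ffunE eq_sym (negbTE ne) scaler0.
have AfE b : A f b = \sum_a f a * A (ket a) b.
  rewrite {1}(fE f) linear_sum sum_ffunE; apply: eq_bigr => a _.
  by rewrite linearZ !ffunE.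
have brk (h : hilb C T) b : braket h (ket b) = (h b)^*.
  rewrite /braket (bigD1 b) //= !ffunE eqxx mulr1 big1 ?addr0 // => a ne.
  by rewrite !ffunE (negbTE ne) mulr0.
rewrite /braket.
transitivity (\sum_a \sum_b (f a)^* * (A (ket a) b)^* * g b).
  apply: eq_bigr => a _; rewrite /adj ext_linE sum_ffunE mulr_sumr.
  apply: eq_bigr => b _; rewrite !ffunE brk -mulrA; congr (_ * _).
  exact: mulrC.
rewrite exchange_big /=; apply: eq_bigr => b _.
rewrite AfE rmorph_sum mulr_suml; apply: eq_bigr => a _.
by rewrite rmorphM.
Qed.

End Basis.

(* (C^d)^{(x) n}, with basis |alpha_1, ..., alpha_n>. *)
Notation qudits C d n := (hilb C {ffun 'I_n -> 'I_d}) (only parsing).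

Section Qudits.
Variables (C : numClosedFieldType) (d n : nat).

Definition tens (v : 'I_n -> 'cV[C]_d) : qudits C d n :=
  [ffun nu : {ffun 'I_n -> 'I_d} => \prod_t v t (nu t) 0].

(* A_1 (x) ... (x) A_n *)
Definition tensor_op (A : 'I_n -> 'M[C]_d) : 'End(qudits C d n) :=
  ext_lin (fun al : {ffun 'I_n -> 'I_d} => tens (fun t => col (al t) (A t))).

Definition perm_op (s : 'S_n) : 'End(qudits C d n) :=
  ext_lin (fun al : {ffun 'I_n -> 'I_d} =>
    ket C [ffun t => al ((s^-1)%g t)] : qudits C d n).

Definition det_tensor (S : 'I_n -> 'I_n -> 'M[C]_d) : 'End(qudits C d n) :=
  \sum_(s : 'S_n)
    (-1) ^+ s *: (tensor_op (fun t => S t (s t)) \o perm_op (s^-1)%g)%VF.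

Lemma tensor_op_tens (A : 'I_n -> 'M[C]_d) (v : 'I_n -> 'cV[C]_d) :
  tensor_op A (tens v) = tens (fun t => A t *m v t).
Proof.
rewrite /tensor_op ext_linE; apply/ffunP => nu; rewrite sum_ffunE ffunE.
under [RHS]eq_bigr do rewrite mxE.
rewrite (bigA_distr_bigA (fun t a => A t (nu t) a * v t a 0)) /=.
apply: eq_bigr => al _; rewrite !ffunE /GRing.scale /= -big_split /=.
by apply: eq_bigr => t _; rewrite mxE mulrC.
Qed.

Lemma perm_op_tens (s : 'S_n) (v : 'I_n -> 'cV[C]_d) :
  perm_op s (tens v) = tens (fun t => v ((s^-1)%g t)).
Proof.
rewrite /perm_op ext_linE; apply/ffunP => nu; rewrite sum_ffunE ffunE.
rewrite (bigD1 [ffun t => nu (s t)]) //= [X in _ + X]big1 ?addr0 => [|al ne].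
  rewrite !ffunE.
  have -> : nu == [ffun t => [ffun t' => nu (s t')] ((s^-1)%g t)] :> {ffun _}.
    by apply/eqP/ffunP => t; rewrite !ffunE permKV.
  rewrite /GRing.scale /= mulr1 [RHS](reindex_inj (@perm_inj _ s)) /=.
  by apply: eq_bigr => t _; rewrite ffunE permK.
rewrite !ffunE; case: eqP => [nuE|_]; last by rewrite scaler0.
case/eqP: ne; apply/ffunP => t; by rewrite nuE !ffunE permK.
Qed.

End Qudits.

(* (j, alpha): block j, internal label alpha *)
Notation mode m d := ('I_m * 'I_d)%type (only parsing).

(* Full fermionic Fock space (the direct sum of the exterior powers of
   C^{dm}); ket {p_1, ..., p_k} with p_1 < ... < p_k for [mode_lt] below
   stands for p_1 /\ ... /\ p_k. *)
Notation fock C m d := (hilb C {set mode m d}) (only parsing).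

Section Fock.
Variables (C : numClosedFieldType) (m d : nat).

Local Notation mode := (mode m d).
Local Notation fock := (fock C m d).

Definition mode_lt (p q : mode) : bool :=
  (p.1 < q.1)%N || (p.1 == q.1) && (p.2 < q.2)%N.

Definition vac : fock := ket C set0.

(* p /\ _ , with the reordering sign *)
Definition creation (p : mode) : 'End(fock) :=
  ext_lin (fun A : {set mode} =>
    (if p \in A then 0
     else (-1) ^+ #|[set q in A | mode_lt q p]| *: ket C (p |: A)) : fock).

(* a^dagger_{p_1} ... a^dagger_{p_k} |vac> for s = [:: p_1; ...; p_k] *)
Definition create_seq (s : seq mode) : fock :=
  foldr (fun p psi => creation p psi) vac s.

(* one fermion in each block b 1, ..., b n, with internal labels al *)
Definition block_state n (b : 'I_n -> 'I_m) (al : {ffun 'I_n -> 'I_d}) : fock :=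
  create_seq [seq (b t, al t) | t <- enum 'I_n].

(* [\sum_(j < m) d] is the size dm in a form carrying the block structure. *)
Definition blk (V : 'M[C]_(\sum_(j < m) d)) (j k : 'I_m) : 'M[C]_d :=
  @submxblock C m m (fun=> d) (fun=> d) V j k.

Definition second_quantized (V : 'M[C]_(\sum_(j < m) d)) (U : 'End(fock)) : Prop :=
  [/\ unitary_op U,
      U vac = vac
    & forall (k : 'I_m) (al : 'I_d),
        (U \o creation (k, al) \o adj U)%VF =
        \sum_(j < m) \sum_(nu < d) blk V j k nu al *: creation (j, nu)].

(* Blocks are numbered from 0, so the occupied input blocks are
   m - n, ..., m - 1. *)
Definition in_block n (hnm : (n <= m)%N) (k : 'I_n) : 'I_m :=
  cast_ord (subnK hnm) (rshift (m - n) k).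

Definition encoding n (hnm : (n <= m)%N) : 'Hom(qudits C d n, fock) :=
  ext_lin (block_state (in_block hnm)).

(* Orthogonal projection onto the span of the occupation states with exactly
   c_j fermions in block j, for every j. *)
Definition record_proj (c : {ffun 'I_m -> bool}) : 'End(fock) :=
  ext_lin (fun A : {set mode} =>
    (if [forall j, #|[set p in A | p.1 == j]| == c j] then ket C A else 0) : fock).

(* Sends a^dagger_{l_1,nu_1} ... a^dagger_{l_n,nu_n} |vac>, which are
   orthonormal for l_1 < ... < l_n, to |nu_1, ..., nu_n>, and the orthogonal
   complement of their span to 0; see [decode_state]. *)
Definition decode n (l : 'I_n -> 'I_m) : 'Hom(fock, qudits C d n) :=
  ext_lin (fun A : {set mode} =>
    [ffun nu => braket (block_state l nu) (ket C A)] : qudits C d n).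

Definition postselect_decode n (c : {ffun 'I_m -> bool}) (l : 'I_n -> 'I_m) :
  'Hom(fock, qudits C d n) := (decode l \o record_proj c)%VF.

(* c has exactly n ones, at positions l_1 < ... < l_n. *)
Definition collision_free n (c : {ffun 'I_m -> bool}) (l : 'I_n -> 'I_m) : Prop :=
  [/\ #|[set j | c j]| = n,
      {homo l : s t / (s < t)%N}
    & [set j | c j] = [set l t | t : 'I_n]].

Lemma mode_ltxx p : mode_lt p p = false.
Proof. by rewrite /mode_lt !ltnn andbF. Qed.

Lemma create_seq_sorted (s : seq mode) :
  pairwise mode_lt s -> create_seq s = ket C [set p in s].
Proof.
elim: s => [_|p s IH] /=.
  by congr ket; apply/setP => p; rewrite !inE.
case/andP => /allP lt_ps /IH ->; rewrite /creation ext_lin_ket inE.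
have [/lt_ps|_] := boolP (p \in s); first by rewrite mode_ltxx.
have -> : [set q in [set p0 in s] | mode_lt q p] = set0.
  apply/setP => q; rewrite !inE; apply/negbTE/negP => /andP[/lt_ps].
  case/orP=> [lt1|/andP[/eqP e1 lt2]] /orP[lt1'|/andP[/eqP e lt2']].
  - by have := ltn_trans lt1 lt1'; rewrite ltnn.
  - by rewrite e ltnn in lt1.
  - by rewrite e1 ltnn in lt1'.
  - by have := ltn_trans lt2 lt2'; rewrite ltnn.
rewrite cards0 expr0 scale1r; congr ket; apply/setP => q.
by rewrite !inE.
Qed.

Lemma decode_state n (l : 'I_n -> 'I_m) (nu : {ffun 'I_n -> 'I_d}) :
  {homo l : s t / (s < t)%N} -> decode l (block_state l nu) = ket C nu.
Proof.
move=> hl.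
have st (al : {ffun 'I_n -> 'I_d}) :
    block_state l al = ket C [set p in [seq (l t, al t) | t <- enum 'I_n]].
  apply: create_seq_sorted; rewrite pairwise_map.
  have : pairwise ltn [seq val i | i <- enum 'I_n].
    rewrite val_enum_ord -sorted_pairwise; last exact: ltn_trans.
    exact: iota_ltn_sorted.
  rewrite pairwise_map; apply: sub_pairwise => s t /= lt_st.
  by rewrite /mode_lt /= hl.
have linj : injective l.
  move=> s t e; apply: val_inj; case: (ltngtP s t) => // /hl.
    by rewrite e ltnn.
  by rewrite e ltnn.
rewrite st /decode ext_lin_ket; apply/ffunP => al; rewrite !ffunE st.
rewrite /braket (bigD1 [set p in [seq (l t, al t) | t <- enum 'I_n]]) //=.
rewrite !ffunE eqxx conjC1 mul1r big1 ?addr0 => [|A ne]; last first.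
  by rewrite !ffunE (negbTE ne) conjC0 mul0r.
congr (nat_of_bool _)%:R; apply/eqP/eqP => [e|-> //].
apply/ffunP => t.
have : (l t, al t) \in [set p in [seq (l t, al t) | t <- enum 'I_n]].
  by rewrite inE map_f ?mem_enum.
by rewrite e inE => /mapP[t' _ [/linj -> ->]].
Qed.

End Fock.

(* Main.v *)
Require Import Defs.
From HB Require Import structures.
From mathcomp Require Import all_boot all_order all_fingroup all_algebra.
From mathcomp Require Import reals.
From mathcomp Require Import complex.
From mathcomp Require Import zify.

Set Implicit Arguments.
Unset Strict Implicit.
Unset Printing Implicit Defensive.

Import Order.TTheory GRing.Theory Num.Theory.
Local Open Scope ring_scope.
Local Open Scope complex_scope.

(** Conjugation by U turns each creation operator into a linear combination of
    creation operators, so U maps a product state to a product of such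
    combinations applied to the vacuum.  The amplitude of such a product on
    the occupation state {g_1 < ... < g_n} is the determinant of the matrix of
    coefficients at the modes g_t, because creating the outermost fermion is
    the Laplace expansion along the first row.  For g_t = (l_t, nu_t), the
    Leibniz formula for the transposed matrix is the matrix element of
    det_tensor between |nu> and |alpha>. *)

Section Basis.
Variables (C : numClosedFieldType) (T : finType).

Lemma eq_on_ket (V : vectType C) (f g : 'Hom(hilb C T, V)) :
  (forall a, f (ket C a) = g (ket C a)) -> f = g.
Proof.
move=> fg; apply/lfunP => h.
have -> : h = \sum_a h a *: ket C a.
  apply/ffunP => b; rewrite sum_ffunE (bigD1 b) //= !ffunE eqxx big1.
    by rewrite addr0 /GRing.scale /= mulr1.
  by move=> a ne; rewrite !ffunE eq_sym (negbTE ne) scaler0.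
by rewrite !linear_sum; apply: eq_bigr => a _; rewrite !linearZ /= fg.
Qed.

Lemma braket_ket (a b : T) : braket (ket C a) (ket C b) = (a == b)%:R.
Proof.
rewrite /braket (bigD1 a) //= !ffunE eqxx conjC1 mul1r big1 ?addr0 // => x ne.
by rewrite !ffunE (negbTE ne) conjC0 mul0r.
Qed.

End Basis.

Section Qudits.
Variables (C : numClosedFieldType) (d n : nat).

(** The permutation operator for [s^-1] relabels [al] to [al \o s], so the summand of [s] has matrix
    element [\prod_t S t (s t) (nu t) (al (s t))], a Leibniz term. *)
Lemma det_tensor_ket (S : 'I_n -> 'I_n -> 'M[C]_d) (al nu : {ffun 'I_n -> 'I_d}) :
  det_tensor S (ket C al) nu =
  \det (\matrix_(t, k) S t k (nu t) (al k)).
Proof.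
rewrite /det_tensor sum_lfunE sum_ffunE; apply: eq_bigr => s _.
rewrite scale_lfunE comp_lfunE /perm_op /tensor_op !ext_lin_ket !ffunE.
congr (_ * _); apply: eq_bigr => t _; by rewrite !mxE ffunE invgK.
Qed.

End Qudits.

Section Fock.
Variables (C : numClosedFieldType) (m d : nat).

Local Notation mode := (mode m d).
Local Notation fock := (fock C m d).

Lemma mode_lt_asym (p q : mode) : mode_lt p q -> mode_lt q p = false.
Proof. by rewrite /mode_lt -!(inj_eq val_inj) /=; lia. Qed.

(** Only the basis state [B :\ p] is sent to a multiple of [ket B]. The sign may be counted in [B]
    itself, since [p] does not precede itself. *)
Lemma creationE (p : mode) (psi : fock) (B : {set mode}) :
  creation C p psi B =
  (-1) ^+ #|[set q in B | mode_lt q p]| * psi (B :\ p) *+ (p \in B).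
Proof.
rewrite /creation ext_linE sum_ffunE.
have [pB|pB] := boolP (p \in B); last first.
  rewrite big1 // => A _; case: ifP => _; rewrite !ffunE ?scaler0 //.
  case: eqP => [e|_]; last by rewrite !scaler0.
  by rewrite e setU11 in pB.
rewrite (bigD1 (B :\ p)) //= !inE eqxx /= big1 ?addr0 => [|A ne].
  rewrite !ffunE setD1K // eqxx mulr1n /GRing.scale /= mulr1 mulrC.
  congr (_ ^+ _ * _); apply: eq_card => q; rewrite !inE.
  by case: eqP => [->|_] /=; rewrite ?mode_ltxx ?andbF.
case: ifP => pA; rewrite !ffunE ?scaler0 //.
case: eqP => [e|_]; last by rewrite !scaler0.
by rewrite e setU1K ?pA // eqxx in ne.
Qed.

Definition increasing n (g : 'I_n -> mode) : Prop :=
  forall s t : 'I_n, (s < t)%N -> mode_lt (g s) (g t).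

Lemma increasing_inj n (g : 'I_n -> mode) : increasing g -> injective g.
Proof.
move=> hg s t e; apply: val_inj; case: (ltngtP s t) => // /hg.
  by rewrite e mode_ltxx.
by rewrite e mode_ltxx.
Qed.

Lemma increasing_lt n (g : 'I_n -> mode) (s t : 'I_n) :
  increasing g -> mode_lt (g s) (g t) = (s < t)%N.
Proof.
move=> hg; case: (ltngtP s t) => [/hg //|lt|/val_inj ->]; last exact: mode_ltxx.
by rewrite mode_lt_asym ?hg.
Qed.

(** This is the wedge product of the one-particle vectors [W k], with index 0 outermost. *)
Definition smeared_state n (W : 'I_n -> mode -> C) : fock :=
  foldr (fun k psi => \sum_p W k p *: creation C p psi) (vac C m d) (enum 'I_n).

(** Induction on [n]: if the outermost operator creates [g i], the remaining ones must fill the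
    other modes, which gives the minor without row 0 and column [i]. *)
Lemma smeared_stateE n (W : 'I_n -> mode -> C) (g : 'I_n -> mode) :
  increasing g ->
  smeared_state W [set g t | t : 'I_n] = \det (\matrix_(k, t) W k (g t)).
Proof.
rewrite /smeared_state; elim: n W g => [|n IH] W g hg.
  rewrite (_ : enum 'I_0 = [::]) /= ?det_mx00; last first.
    by apply: size0nil; rewrite size_enum_ord.
  rewrite ffunE (_ : imset _ _ = set0) ?eqxx //.
  by apply/setP => p; rewrite inE; apply/imsetP => -[[]].
rewrite enum_ordSl /= foldr_map sum_ffunE (expand_det_row _ ord0).
set B := [set g t | t : _]; set psi := foldr _ _ _.
have ginj := increasing_inj hg.
rewrite (bigID (mem B)) /= [X in _ + X]big1 ?addr0; last first.
  by move=> p pB; rewrite ffunE creationE (negbTE pB) mulr0n scaler0.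
rewrite big_imset /=; last by move=> ? ? _ _; apply: ginj.
apply: eq_bigr => i _; rewrite ffunE creationE imset_f // mulr1n mxE.
congr (_ * _); rewrite /cofactor add0n; congr (_ ^+ _ * _).
  (* Exactly [i] modes of [B] precede [g i], so the reordering sign is the cofactor sign. *)
  have -> : [set q in B | mode_lt q (g i)] =
            g @: [set t : 'I_n.+1 | (t < i)%N].
    apply/setP => q; rewrite inE; apply/andP/imsetP.
      by case=> /imsetP[t _ ->]; rewrite increasing_lt // => lt; exists t; rewrite ?inE.
    by case=> t; rewrite inE => lt ->; rewrite imset_f // increasing_lt.
  rewrite card_imset // -sum1dep_card.
  rewrite (big_ord_narrow (F := fun=> 1%N) (ltnW (ltn_ord i))) /=.
  by rewrite sum1_card card_ord.
have -> : B :\ g i = [set g (lift i t) | t : 'I_n].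
  apply/setP => q; rewrite !inE; apply/andP/imsetP.
    case=> ne /imsetP[t _ e]; rewrite e (inj_eq ginj) in ne.
    case: (unliftP i t) ne e => [t' ->|->] ne e; last by rewrite eqxx in ne.
    by exists t'.
  by case=> t _ ->; rewrite (inj_eq ginj) eq_sym neq_lift imset_f.
rewrite /psi (IH (fun k => W (lift ord0 k))).
  by congr (\det _); apply/matrixP => k t; rewrite !mxE.
(* Skipping the index [i] keeps the family increasing, as the induction hypothesis requires. *)
by move=> s t lt; apply: hg; rewrite /= /bump; lia.
Qed.

Lemma second_quantized_block_state (V : 'M[C]_(\sum_(j < m) d)) (U : 'End(fock))
    n (b : 'I_n -> 'I_m) (al : {ffun 'I_n -> 'I_d}) :
  second_quantized V U ->
  U (block_state C b al) =
  smeared_state (fun k (p : mode) => blk V p.1 (b k) p.2 (al k)).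
Proof.
case=> [[UadjU _] Uvac Ucreate].
rewrite /block_state /create_seq /smeared_state foldr_map.
elim: (enum 'I_n) => //= k s <-.
set psi := foldr _ _ _.
(* Inserting [adj U \o U = \1] after the creation operator exposes its conjugate by [U], acting on
   the state already treated. *)
transitivity ((U \o creation C (b k, al k) \o adj U)%VF (U psi)).
  rewrite !comp_lfunE; congr (U (_ _)).
  by rewrite -comp_lfunE UadjU id_lfunE.
rewrite Ucreate pair_big /= sum_lfunE; apply: eq_bigr => -[j nu] _ /=.
by rewrite scale_lfunE.
Qed.

Lemma increasing_block n (l : 'I_n -> 'I_m) (nu : {ffun 'I_n -> 'I_d}) :
  {homo l : s t / (s < t)%N} ->
  increasing (fun t => (l t, nu t)).
Proof. by move=> l_lt s t lt; rewrite /mode_lt /= l_lt. Qed.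

(** The modes are created in increasing order whatever the labels [nu], so no sign appears. *)
Lemma block_state_sorted n (l : 'I_n -> 'I_m) (nu : {ffun 'I_n -> 'I_d}) :
  {homo l : s t / (s < t)%N} ->
  block_state C l nu = ket C [set (l t, nu t) | t : 'I_n].
Proof.
move=> l_lt; rewrite /block_state create_seq_sorted.
  congr ket; apply/setP => p; rewrite inE; apply/mapP/imsetP => -[t _ ->].
    by exists t.
  by exists t; rewrite ?mem_enum.
have : pairwise ltn [seq val i | i <- enum 'I_n].
  rewrite val_enum_ord -sorted_pairwise; last exact: ltn_trans.
  exact: iota_ltn_sorted.
rewrite !pairwise_map; apply: sub_pairwise => s t; exact: increasing_block.
Qed.

(** The occupation state decoded to [nu] agrees with the record [c], so the projection leaves its
    amplitude unchanged. *)
Lemma postselect_decodeE n (l : 'I_n -> 'I_m) (c : {ffun 'I_m -> bool})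
    (psi : fock) (nu : {ffun 'I_n -> 'I_d}) :
  {homo l : s t / (s < t)%N} ->
  [set j | c j] = [set l t | t : 'I_n] ->
  postselect_decode C d c l psi nu = psi [set (l t, nu t) | t : 'I_n].
Proof.
move=> l_lt cl; set A := imset _ _.
have ginj := increasing_inj (increasing_block nu l_lt).
have linj : injective l.
  by move=> s t e; apply: val_inj; case: (ltngtP s t) => // /l_lt; rewrite e ltnn.
(* Block [l t] contains only [(l t, nu t)], by injectivity of [l]; a block outside the image of [l]
   is empty. *)
have Ac : [forall j, #|[set p in A | p.1 == j]| == c j].
  apply/forallP => j.
  have -> : c j = (j \in [set l t | t : 'I_n]) by rewrite -cl inE.
  have [/imsetP[t _ ->]|jl] := boolP (j \in [set l t | t : 'I_n]).
    rewrite (_ : [set _ in _ | _] = [set (l t, nu t)]) ?cards1 //.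
    apply/setP => p; rewrite !inE; apply/andP/eqP => [[/imsetP[s _ ->] /eqP]|->].
      by move=> /linj ->.
    by split=> //=; apply/imsetP; exists t.
  rewrite (_ : [set _ in _ | _] = set0) ?cards0 //.
  apply/setP => p; rewrite !inE; apply/andP => -[/imsetP[s _ ->] /eqP e].
  rewrite -e in jl; case/negP: jl; exact: imset_f.
rewrite comp_lfunE /decode ext_linE sum_ffunE (bigD1 A) //= big1 ?addr0.
  rewrite !ffunE block_state_sorted // braket_ket eqxx /record_proj ext_linE sum_ffunE.
  rewrite (bigD1 A) //= Ac !ffunE eqxx big1 ?addr0.
    by rewrite /GRing.scale /= !mulr1.
  move=> B ne; case: ifP => _; rewrite !ffunE ?scaler0 //.
  by rewrite eq_sym (negbTE ne) scaler0.
move=> B ne; rewrite !ffunE block_state_sorted // braket_ket eq_sym (negbTE ne).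
by rewrite scaler0.
Qed.

End Fock.

Theorem lemma2 (R : realType) (d m n : nat)
    (hd : (2 <= d)%N) (hn : (1 <= n)%N) (hnm : (n <= m)%N)
    (V : 'M[R[i]]_(\sum_(j < m) d)) (hV : V \is unitarymx)
    (U : 'End(fock R[i] m d)) (hU : second_quantized V U)
    (c : {ffun 'I_m -> bool}) (l : 'I_n -> 'I_m) (hc : collision_free c l) :
  (postselect_decode R[i] d c l \o U \o encoding R[i] d hnm)%VF =
  det_tensor (fun t k : 'I_n => blk V (l t) (in_block hnm k)).
Proof.
case: hc => _ l_lt cl; apply: eq_on_ket => al; apply/ffunP => nu.
rewrite !comp_lfunE /encoding ext_lin_ket (second_quantized_block_state _ _ hU).
rewrite -comp_lfunE postselect_decodeE // (smeared_stateE _ (increasing_block nu l_lt)).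
(* The rows of the amplitude matrix are input blocks, those of the [det_tensor] matrix are output
   blocks. *)
rewrite det_tensor_ket -det_tr; congr (\det _).
by apply/matrixP => t k; rewrite !mxE.
Qed.
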